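(* Let $a,b,p,q$ be complex numbers with $p\neq 0$, $q\neq 0$, and let $(W_j)$, $(U_j)$ be as defined in the context. If $n$ is a non-negative integer, $m$ is any real number and $r$, $s$ and $t$ are any integers, then \[ \sum_{k = 0}^n \binom nk\binom{m + k}{k}q^{rk} U_r^{n - k} U_s^kW_{t - (r + s)k + sn} = \sum_{k = 0}^n \binom nk\binom mk q^{rk} U_{r + s}^{n - k} U_s^kW_{t - rk}. \]
   Context: The Horadam sequence $W_j=W_j(a,b;p,q)$ is defined by $W_0=a$, $W_1=b$, $W_j=pW_{j-1}-qW_{j-2}$ for $j\ge 2$, and extended to negative indices by $W_{-j}=\frac{1}{q}(pW_{-j+1}-W_{-j+2})$. The Lucas sequence of the first kind is $U_j=W_j(0,1;p,q)$. For a real number $x$ and a non-negative integer $k$, $\binom{x}{k}=x(x-1)\cdots(x-k+1)/k!$. *)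

(* Defs.v *)
From mathcomp Require Import all_boot all_order all_algebra.
From mathcomp Require Export reals complex.

Set Implicit Arguments.
Unset Strict Implicit.
Unset Printing Implicit Defensive.

Import Order.TTheory GRing.Theory Num.Theory.
Local Open Scope ring_scope.

Section Horadam.
Variables (F : fieldType) (a b p q : F).

Fixpoint horadam_pos (j : nat) : F :=
  match j with
  | 0 => a
  | j1.+1 => match j1 with
             | 0 => b
             | j2.+1 => p * horadam_pos j1 - q * horadam_pos j2
             end
  end.

(* horadam_neg j is W_{-j}; at j = 1 the backward recurrence refers to W_1 = b. *)
Fixpoint horadam_neg (j : nat) : F :=
  match j with
  | 0 => a
  | j1.+1 => match j1 with
             | 0 => q^-1 * (p * a - b)
             | j2.+1 => q^-1 * (p * horadam_neg j1 - horadam_neg j2)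
             end
  end.

(* Negz j stands for - (j + 1). *)
Definition horadam (j : int) : F :=
  match j with
  | Posz j => horadam_pos j
  | Negz j => horadam_neg j.+1
  end.

Lemma horadam0 : horadam 0 = a. Proof. by []. Qed.

Lemma horadam1 : horadam 1 = b. Proof. by []. Qed.

Lemma horadam_ge2 (j : nat) : (2 <= j)%N ->
  horadam j%:Z = p * horadam (j%:Z - 1) - q * horadam (j%:Z - 2).
Proof.
case: j => [|[|j]] // _.
have -> : j.+2%:Z - 1 = j.+1%:Z by rewrite -addn1 PoszD addrK.
have -> : j.+2%:Z - 2 = j%:Z by rewrite -addn2 PoszD addrK.
by [].
Qed.

Lemma horadam_lt0 (j : nat) : (1 <= j)%N ->
  horadam (- j%:Z) =
  q^-1 * (p * horadam (- j%:Z + 1) - horadam (- j%:Z + 2)).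
Proof.
case: j => [|[|[|j]]] // _.
have -> : - j.+3%:Z + 1 = - j.+2%:Z.
  by rewrite -(addn1 j.+2) PoszD opprD addrNK.
have -> : - j.+3%:Z + 2 = - j.+1%:Z.
  by rewrite -(addn2 j.+1) PoszD opprD addrNK.
by rewrite -!NegzE.
Qed.

End Horadam.

Definition lucasU (F : fieldType) (p q : F) (j : int) : F :=
  horadam 0 1 p q j.

Definition gbinom (F : fieldType) (x : F) (k : nat) : F :=
  (\prod_(i < k) (x - i%:R)) / k`!%:R.

(* Main.v *)
(* With E the shift t |-> t + 1 acting on W, the addition formula
     U_r W_{t+s} + q^r U_s W_{t-r} = U_{r+s} W_t
   says that A = U_r E^s and B = q^r U_s E^(-r) satisfy A + B = U_{r+s} on W.
   The theorem is then the polynomial identity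
     sum_k C(n,k) C(m+k,k) A^(n-k) B^k = sum_k C(n,k) C(m,k) (A+B)^(n-k) B^k,
   which follows by expanding (A+B)^(n-k) and applying Vandermonde's
   convolution sum_k C(j,k) C(m,k) = C(m+j,j). *)
Require Import Defs.
From mathcomp Require Import all_boot all_order all_algebra.
From mathcomp Require Import reals complex.
From mathcomp Require Import zify ring.

Import Order.TTheory GRing.Theory Num.Theory.
Local Open Scope ring_scope.
Local Open Scope complex_scope.

(** Pascal's rule under a sum; it drives the inductions for Vandermonde and for the expansion of the
    n-th power. *)
Lemma sum_binS (A : pzRingType) (n : nat) (f : nat -> A) :
  \sum_(k < n.+2) 'C(n.+1, k)%:R * f k
  = \sum_(k < n.+1) 'C(n, k)%:R * (f k + f k.+1).
Proof.
under [RHS]eq_bigr => k _ do rewrite mulrDr.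
rewrite big_split /= big_ord_recl [in RHS]big_ord_recl /= !bin0 -addrA.
congr (_ + _).
under eq_bigr => k _ do rewrite /= /bump add1n binS natrD mulrDl.
by rewrite big_split /= big_ord_recr /= bin_small // mul0r addr0.
Qed.

(** With j = k + i, this is C(n,k) C(n-k,i) = C(n,j) C(j,k) followed by an exchange of the two
    sums. *)
Lemma sum_bin_trinomial (A : comPzRingType) (n : nat) (f : nat -> nat -> A) :
  \sum_(k < n.+1) \sum_(i < (n - k).+1)
     'C(n, k)%:R * 'C(n - k, i)%:R * f k (k + i)%N
  = \sum_(j < n.+1) \sum_(k < j.+1) 'C(n, j)%:R * 'C(j, k)%:R * f k j.
Proof.
pose g k j := 'C(n, j)%:R * 'C(j, k)%:R * f k j.
transitivity (\sum_(k < n.+1) \sum_(j < n.+1 | (k <= j)%N) g k j).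
  apply: eq_bigr => -[k /= lekn] _; rewrite ltnS in lekn.
  rewrite -(big_mkord (fun=> true)
    (fun i => 'C(n, k)%:R * 'C(n - k, i)%:R * f k (k + i)%N)).
  rewrite -(big_mkord (fun j => k <= j)%N (g k)) /= -(big_nat_widenl k 0 n.+1 xpredT) //.
  rewrite [RHS](big_addn 0 n.+1 k) subSn //.
  apply: eq_big_nat => i /andP[_ lei]; rewrite ltnS in lei.
  rewrite /g [(k + i)%N]addnC -!natrM; congr (_%:R * _).
  have leikn : (i + k <= n)%N by lia.
  have := bin_fact leikn; have := bin_fact lekn; have := bin_fact lei.
  have := bin_fact (leq_addl i k); rewrite addnK -subnDA [(k + i)%N]addnC.
  move=> h1 h2 h3 h4.
  (* Division is avoided: multiplied by k! i! (n-(i+k))!, both products of binomials become n!. *)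
  apply/eqP; rewrite -(eqn_pmul2r (fact_gt0 k)) -(eqn_pmul2r (fact_gt0 i)).
  rewrite -(eqn_pmul2r (fact_gt0 (n - (i + k)))); apply/eqP.
  have -> : ('C(n, k) * 'C(n - k, i) * k`! * i`! * (n - (i + k))`! = n`!)%N.
    by rewrite -h3 -h2; ring.
  by rewrite -h4 -h1; ring.
rewrite (exchange_big_dep xpredT) //=; apply: eq_bigr => -[j /= ltj] _.
by rewrite -(big_mkord (fun k => k <= j)%N (g^~ j)) -(big_mkord xpredT (g^~ j))
  [RHS](big_nat_widen _ _ n.+1).
Qed.

(** All three products share x(x-1)...(x-k+1); what remains is x + 1 = (x - k) + (k + 1). *)
Lemma gbinomS (F : numFieldType) (x : F) (k : nat) :
  gbinom (x + 1) k.+1 = gbinom x k.+1 + gbinom x k.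
Proof.
rewrite /gbinom big_ord_recl [in RHS]big_ord_recr /= factS natrM.
have -> : \prod_(i < k) (x + 1 - (bump 0 i)%:R) = \prod_(i < k) (x - i%:R).
  by apply: eq_bigr => i _; rewrite /bump add1n -natr1; ring.
have h1 : k.+1%:R != 0 :> F by rewrite pnatr_eq0.
have h2 : k`!%:R != 0 :> F by rewrite pnatr_eq0 -lt0n fact_gt0.
rewrite -natr1 in h1 *; field; exact/andP.
Qed.

(** The offset [i] is there for the induction on [j]: Pascal's rule on C(j,k) produces the lower
    indices i + k and i + k + 1. *)
Lemma gbinom_Vandermonde (F : numFieldType) (x : F) (i j : nat) :
  \sum_(k < j.+1) 'C(j, k)%:R * gbinom x (i + k) = gbinom (x + j%:R) (i + j).
Proof.
elim: j i => [|j IHj] i; first by rewrite big_ord1 bin0 mul1r addr0.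
rewrite (sum_binS _ _ (fun k => gbinom x (i + k))) addnS -natr1 addrA gbinomS.
rewrite -addSn -!IHj -big_split /=; apply: eq_bigr => k _.
by rewrite -mulrDr addnS addSn addrC.
Qed.

Section LucasRecurrence.
Variables (F : fieldType) (p q : F).
Hypothesis q_neq0 : q != 0.

(** Centred at j and required on all of [int], one equation covers both the forward and the backward
    recurrence. *)
Definition lucas_rec (f : int -> F) : Prop :=
  forall j : int, f (j + 1) = p * f j - q * f (j - 1).

Lemma horadam_rec (a b : F) : lucas_rec (horadam a b p q).
Proof.
case=> [[|j]|j].
- rewrite sub0r add0r -[- 1]/(Negz 0) /=; by field.
- have := horadam_ge2 a b p q (isT : 2 <= j.+2)%N.
  have -> : j.+2%:Z - 1 = j.+1%:Z by lia.
  have -> : j.+2%:Z - 2 = j.+1%:Z - 1 by lia.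
  by have -> : j.+1%:Z + 1 = j.+2%:Z by lia.
have := horadam_lt0 a b p q (isT : 1 <= j.+2)%N.
have -> : - j.+2%:Z + 1 = Negz j by lia.
have -> : - j.+2%:Z + 2 = Negz j + 1 by lia.
have -> : - j.+2%:Z = Negz j - 1 by lia.
by move=> ->; field.
Qed.

Lemma lucas_rec_shift (f : int -> F) (t : int) :
  lucas_rec f -> lucas_rec (fun j => f (t + j)).
Proof. by move=> rec_f j; rewrite !addrA. Qed.

(** The roots of x^2 - p x + q have product q, so x -> q/x swaps them: reflecting the index and
    rescaling by q^j preserves the recurrence. *)
Lemma lucas_rec_reflect (f : int -> F) (t : int) :
  lucas_rec f -> lucas_rec (fun j => q ^ j * f (t - j)).
Proof.
move=> rec_f j; have := rec_f (t - j).
have -> : t - (j + 1) = t - j - 1 by ring.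
have -> : t - (j - 1) = t - j + 1 by ring.
by move=> ->; rewrite !expfzDr // expr1z exprN1; field.
Qed.

Lemma lucas_rec_lin (c d : F) (f g : int -> F) :
  lucas_rec f -> lucas_rec g -> lucas_rec (fun j => c * f j + d * g j).
Proof. by move=> rec_f rec_g j; rewrite rec_f rec_g; ring. Qed.

Lemma lucas_rec_inj (f g : int -> F) : lucas_rec f -> lucas_rec g ->
  f 0 = g 0 -> f 1 = g 1 -> f =1 g.
Proof.
move=> rec_f rec_g fg0 fg1.
(* The induction moves outwards in both directions, so two consecutive values are carried at each
   end. *)
suff fg j : f j%:Z = g j%:Z /\ f (j%:Z + 1) = g (j%:Z + 1) /\
            f (- j%:Z) = g (- j%:Z) /\ f (- j%:Z + 1) = g (- j%:Z + 1).
  by case=> j; [case: (fg j) | rewrite NegzE; case: (fg j.+1) => _ [_ []]].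
elim: j => [|j [fgj [fgj1 [fgNj fgNj1]]]]; first by rewrite oppr0 add0r.
have -> : j.+1%:Z = j%:Z + 1 by lia.
have -> : - (j%:Z + 1) = - j%:Z - 1 by lia.
rewrite subrK; split=> //; split; last split=> //.
  by rewrite rec_f rec_g addrK fgj fgj1.
have qV h : lucas_rec h ->
    h (- j%:Z - 1) = q^-1 * (p * h (- j%:Z) - h (- j%:Z + 1)).
  by move=> ->; field.
by rewrite !qV // fgNj fgNj1.
Qed.

(** As functions of s both sides satisfy the recurrence, so agreement at s = 0 and s = 1
    suffices. *)
Lemma lucas_rec_add (f : int -> F) (r s t : int) : lucas_rec f ->
  lucasU p q r * f (t + s) + q ^ r * lucasU p q s * f (t - r)
  = lucasU p q (r + s) * f t.
Proof.
move=> rec_f; have rec_U : lucas_rec (lucasU p q) by exact: horadam_rec.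
have U2 : lucasU p q (1 + 1) = p by rewrite rec_U /lucasU /=; ring.
have lin c d g h := @lucas_rec_lin c d g h.
(* The case s = 1, proved by the same uniqueness argument in r. The coefficients 1 and 0 only give
   both sides the shape of [lucas_rec_lin]. *)
have step r' : f (t + 1) * lucasU p q r' + 1 * (q ^ r' * f (t - r'))
               = f t * lucasU p q (1 + r') + 0 * lucasU p q r'.
  move: r'; apply: lucas_rec_inj.
  - exact/lin/lucas_rec_reflect.
  - by apply: lin => //; exact: lucas_rec_shift.
  - by rewrite addr0 expr0z subr0 /lucasU /=; ring.
  by rewrite U2 expr1z rec_f /lucasU /=; ring.
have : lucasU p q r * f (t + s) + (q ^ r * f (t - r)) * lucasU p q s
       = f t * lucasU p q (r + s) + 0 * lucasU p q s.
  move: s; apply: lucas_rec_inj.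
  - by apply: lin => //; exact: lucas_rec_shift.
  - by apply: lin => //; exact: lucas_rec_shift.
  - by rewrite !addr0 /lucasU /=; ring.
  have U1 : lucasU p q 1 = 1 by [].
  rewrite U1 mul0r addr0 addrC -[f t * _]addr0 [r + 1]addrC.
  by rewrite -(mul0r (lucasU p q r)) -step; ring.
by rewrite mul0r addr0 [RHS]mulrC => <-; ring.
Qed.

Lemma lucas_rec_expand (f : int -> F) (n : nat) (r s t : int) : lucas_rec f ->
  lucasU p q (r + s) ^+ n * f t
  = \sum_(k < n.+1) 'C(n, k)%:R *
      (q ^ (r * k%:Z) * lucasU p q r ^+ (n - k) * lucasU p q s ^+ k
       * f (t - (r + s) * k%:Z + s * n%:Z)).
Proof.
move=> rec_f; elim: n => [|n IHn].
  by rewrite big_ord1 bin0 !mulr0 subr0 addr0 expr0z; ring.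
rewrite exprS -mulrA IHn mulr_sumr.
rewrite (sum_binS _ _ (fun k => q ^ (r * k%:Z) * lucasU p q r ^+ (n.+1 - k)
  * lucasU p q s ^+ k * f (t - (r + s) * k%:Z + s * n.+1%:Z))).
apply: eq_bigr => -[k /= lekn] _; rewrite ltnS in lekn.
rewrite subSS subSn // !exprS.
(* The terms k and k + 1 for exponent n + 1 sit at t' + s and t' - r, so the addition formula at t'
   merges them. *)
set t' := t - (r + s) * k%:Z + s * n%:Z.
have -> : t - (r + s) * k%:Z + s * n.+1%:Z = t' + s by rewrite /t'; lia.
have -> : t - (r + s) * k.+1%:Z + s * n.+1%:Z = t' - r by rewrite /t'; lia.
have -> : r * k.+1%:Z = r * k%:Z + r by lia.
rewrite expfzDr // mulrCA; congr (_ * _).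
by rewrite mulrCA -lucas_rec_add //; ring.
Qed.

(** The weights [c] stay arbitrary, since m enters only through Vandermonde. Regrouping by k leaves
    an inner sum over i = j - k, which [lucas_rec_expand] collapses with exponent n - k at t -
    rk. *)
Lemma lucas_rec_binomial_transform (f : int -> F) (c : nat -> F) (n : nat)
    (r s t : int) : lucas_rec f ->
  \sum_(j < n.+1) 'C(n, j)%:R * (\sum_(k < j.+1) 'C(j, k)%:R * c k)
     * q ^ (r * j%:Z) * lucasU p q r ^+ (n - j) * lucasU p q s ^+ j
     * f (t - (r + s) * j%:Z + s * n%:Z)
  = \sum_(k < n.+1) 'C(n, k)%:R * c k * q ^ (r * k%:Z)
     * lucasU p q (r + s) ^+ (n - k) * lucasU p q s ^+ k * f (t - r * k%:Z).
Proof.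
move=> rec_f.
pose T j := q ^ (r * j%:Z) * lucasU p q r ^+ (n - j) * lucasU p q s ^+ j
            * f (t - (r + s) * j%:Z + s * n%:Z).
transitivity (\sum_(j < n.+1) \sum_(k < j.+1)
    'C(n, j)%:R * 'C(j, k)%:R * (c k * T j)).
  apply: eq_bigr => j _; rewrite mulr_sumr !mulr_suml.
  by apply: eq_bigr => k _; rewrite /T; ring.
rewrite -(sum_bin_trinomial _ _ (fun k j => c k * T j)).
apply: eq_bigr => -[k /= lekn] _; rewrite ltnS in lekn.
set U := lucasU p q.
have -> : 'C(n, k)%:R * c k * q ^ (r * k%:Z) * U (r + s) ^+ (n - k) * U s ^+ k
          * f (t - r * k%:Z)
        = 'C(n, k)%:R * c k * q ^ (r * k%:Z) * U s ^+ k
          * (U (r + s) ^+ (n - k) * f (t - r * k%:Z)) by ring.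
rewrite lucas_rec_expand // mulr_sumr; apply: eq_bigr => i _.
have -> : t - r * k%:Z - (r + s) * i%:Z + s * (n - k)%:Z
        = t - (r + s) * (k + i)%N%:Z + s * n%:Z.
  have -> : n%:Z = k%:Z + (n - k)%:Z by lia.
  by rewrite PoszD; ring.
by rewrite /T -/U PoszD mulrDr expfzDr // subnDA exprD; ring.
Qed.

End LucasRecurrence.

Theorem theorem53 (R : realType) (a b p q : R[i]) (hp : p != 0) (hq : q != 0)
    (n : nat) (m : R) (r s t : int) :
  let W := horadam a b p q in
  let U := lucasU p q in
  \sum_(k < n.+1)
     'C(n, k)%:R * (gbinom (m + k%:R) k)%:C * q ^ (r * k%:Z)
     * U r ^+ (n - k) * U s ^+ k * W (t - (r + s) * k%:Z + s * n%:Z)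
  = \sum_(k < n.+1)
     'C(n, k)%:R * (gbinom m k)%:C * q ^ (r * k%:Z)
     * U (r + s) ^+ (n - k) * U s ^+ k * W (t - r * k%:Z).
Proof.
move=> W U.
rewrite -(lucas_rec_binomial_transform _ _ _ hq W (fun k => (gbinom m k)%:C));
  last exact: horadam_rec.
apply: eq_bigr => k _; do 5!congr (_ * _).
(* Vandermonde with offset 0 turns C(m+k,k) into the binomial transform of C(m,j). *)
rewrite -[X in gbinom _ X]add0n -gbinom_Vandermonde rmorph_sum.
by apply: eq_bigr => j _; rewrite rmorphM rmorph_nat.
Qed.
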